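(* Let $n\ge 1$, let $G=\mathrm{Iso}_1(n)$, let $m$ be the number of partitions of $n$, and let $\mathfrak{B}$, $B_1,\dots,B_M$, $m_k$ and the basic blocks $B_{ik}$ ($1\le i\le M$, $0\le k<2m$) be as defined in the context. Then the algebra $\mathfrak{B}$ is $*$-isomorphic to $$\bar{\mathfrak{B}}=\bigoplus_{k=0}^{2m-1}\mathbb{C}^{m_k\times m_k},$$ and $\bar{\mathfrak{B}}$ is generated (as a $\mathbb{C}$-algebra) by the diagonal joins $\mathrm{diag}(B_{i0},B_{i1},\dots,B_{i,2m-1})$, $i=1,\dots,M$, of the basic blocks. (Indices $k$ with $m_k=0$ contribute nothing and are omitted.)
   Context: $\mathrm{Sym}(n)$ is the symmetric group on $\{1,\dots,n\}$. $G=\mathrm{Iso}_1(n)\cong\mathrm{Sym}(n)\times\mathbb{Z}/2$ is the group acting on the set $\mathrm{Sym}(n)$ generated by the conjugations $\phi\mapsto\alpha\phi\alpha^{-1}$, $\alpha\in \mathrm{Sym}(n)$, and inversion $\iota:\phi\mapsto\phi^{-1}$ (regarded as the abstract direct product $\mathrm{Sym}(n)\times\mathbb{Z}/2$ acting this way). It has $2m$ irreducible complex characters $\chi_0,\dots,\chi_{2m-1}$, where $m$ is the number of partitions of $n$. Let $O_1,\dots,O_M$ be the orbits of $G$ acting diagonally on $\mathrm{Sym}(n)^2$, and let $B_i\in M_{n!}(\mathbb{C})$ (rows and columns indexed by $\mathrm{Sym}(n)$) be the zero-one matrix with $B_i(\phi,\psi)=1$ if and only if $(\phi,\psi)\in O_i$.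 Let $\mathfrak{B}$ be the $\mathbb{C}$-linear span of $B_1,\dots,B_M$; it is the algebra of all matrices commuting with the permutation matrices $\widehat\gamma$, $\gamma\in G$, of the action of $G$ on $\mathrm{Sym}(n)$. For $0\le k<2m$ put $\epsilon_k=\frac{\chi_k(\mathrm{id})}{2\,n!}\sum_{\gamma\in G}\chi_k(\gamma)\widehat\gamma$, and let $W_k\subseteq\mathbb{C}^{\mathrm{Sym}(n)}$ be the range of $\epsilon_k$. As a $G$-module, $W_k$ is a direct sum of $m_k$ mutually isomorphic irreducible submodules, each of dimension $d_k=\chi_k(\mathrm{id})$; this defines the multiplicity $m_k\ge 0$. For each $k$ with $m_k>0$, choose a vector $v_k\in W_k$ such that $U_k:=\mathfrak{B}v_k$ has dimension $m_k$, and choose an orthogonal basis $(u_1,\dots,u_{m_k})$ of $U_k$. The basic block $B_{ik}$ of $B_i$ is the $m_k\times m_k$ matrix with entries $$B_{ik}(j,l)=\frac{\langle B_iu_j,u_l\rangle}{\|u_j\|\,\|u_l\|},\qquad 1\le j,l\le m_k,$$ where $\langle\cdot,\cdot\rangle$ is the standard Hermitian inner product, linear in the first argument. A $*$-isomorphism of matrix algebras is a bijective $\mathbb{C}$-linear map $\kappa$ with $\kappa(XY)=\kappa(X)\kappa(Y)$ and $\kappa(X^* )=\kappa(X)^*$, where $X^*$ is the conjugate transpose. *)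

(* Defs.v *)
From HB Require Import structures.
From mathcomp Require Import all_boot all_order all_fingroup all_algebra all_character.
From mathcomp Require Import complex reals.

Set Implicit Arguments.
Unset Strict Implicit.
Unset Printing Implicit Defensive.

Import GroupScope GRing.Theory Num.Theory.
Local Open Scope ring_scope.

(* Partitions of n, as nonincreasing sequences of length n padded with zeros. *)
Definition npartitions (n : nat) : nat :=
  #|[set t : n.-tuple 'I_n.+1 |
      sorted geq (map val t) & sumn (map val t) == n]|.

(* MathComp composes permutations from left to right, (s * t) x = t (s x), so
   that phi ^ a = a^-1 * phi * a is the function composition a o phi o a^-1 and
   the group acts on the right.  Replacing the product of 'S_n by the opposite
   one changes neither the transformations of 'S_n, nor the orbits, nor the set
   of irreducible characters of the group. *)
Definition Iso1 (n : nat) : finGroupType := ('S_n * 'Z_2)%type.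

Definition iso1_fun n (phi : 'S_n) (g : Iso1 n) : 'S_n :=
  if g.2 == 0 then (phi ^ g.1)%g else ((phi ^ g.1)^-1)%g.

Lemma iso1_fun1 n (phi : 'S_n) : iso1_fun phi 1%g = phi.
Proof. by rewrite /iso1_fun /= conjg1. Qed.

Lemma iso1_funM n (phi : 'S_n) (g h : Iso1 n) :
  iso1_fun phi (g * h)%g = iso1_fun (iso1_fun phi g) h.
Proof.
case: g h => [a s] [b t]; rewrite /iso1_fun /=.
have s01 (z : 'Z_2) : z = 0 \/ z = 1.
  by case: z => [[|[|]]] // p; [left|right]; apply/val_inj.
by case: (s01 s) => ->; case: (s01 t) => -> /=; rewrite ?conjgM ?conjVg ?invgK.
Qed.

Definition iso1_action n : {action Iso1 n &-> 'S_n} :=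
  TotalAction (@iso1_fun1 n) (@iso1_funM n).

Definition iso1_fun2 n (x : 'S_n * 'S_n) (g : Iso1 n) : 'S_n * 'S_n :=
  (iso1_action n x.1 g, iso1_action n x.2 g).

Lemma iso1_fun21 n (x : 'S_n * 'S_n) : iso1_fun2 x 1%g = x.
Proof. by case: x => a b; rewrite /iso1_fun2 /= !iso1_fun1. Qed.

Lemma iso1_fun2M n (x : 'S_n * 'S_n) (g h : Iso1 n) :
  iso1_fun2 x (g * h)%g = iso1_fun2 (iso1_fun2 x g) h.
Proof. by rewrite /iso1_fun2 /= !iso1_funM. Qed.

Definition iso1_diag_action n : {action Iso1 n &-> 'S_n * 'S_n} :=
  TotalAction (@iso1_fun21 n) (@iso1_fun2M n).

Definition iso1_orbits n : {set {set 'S_n * 'S_n}} :=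
  [set orbit (iso1_diag_action n) [set: Iso1 n] x | x : 'S_n * 'S_n].

(* Matrices with rows and columns indexed by 'S_n: the index i : 'I_(nperm n)
   stands for the permutation enum_val i. *)
Definition nperm (n : nat) : nat := #|{: 'S_n}|.

Section OverC.

Variables (C : numClosedFieldType) (n : nat).

Local Notation G := [set: Iso1 n].
Local Notation N := (nperm n).

Definition orbit_mx (w : {set 'S_n * 'S_n}) : 'M[C]_N :=
  \matrix_(i, j) ((enum_val i, enum_val j) \in w)%:R.

Definition frakB : {vspace 'M[C]_N} :=
  <<[seq orbit_mx w | w <- enum (iso1_orbits n)]>>%VS.

(* hat_mx g maps the basis vector e_psi to e_(g psi), on column vectors. *)
Definition hat_mx (g : Iso1 n) : 'M[C]_N :=
  \matrix_(i, j) (enum_val i == iso1_action n (enum_val j) g)%:R.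

(* Library representations act on row vectors: x^T *m (hat_mx g)^T is the
   transpose of hat_mx g *m x. *)
Lemma hat_mx_repr : mx_repr G (fun g => (hat_mx g)^T).
Proof.
split=> [|g h _ _]; apply/matrixP=> i j; rewrite !mxE.
  by rewrite /= iso1_fun1 (inj_eq enum_val_inj) eq_sym.
rewrite /= iso1_funM.
rewrite (bigD1 (enum_rank (iso1_fun (enum_val i) g))) //= big1 ?addr0.
  by rewrite !mxE enum_rankK eqxx mul1r.
move=> k; rewrite !mxE /= => kN.
by rewrite (can2_eq enum_valK enum_rankK) (negPf kN) mul0r.
Qed.

Definition hat_repr : mx_representation C G N := MxRepresentation hat_mx_repr.

Definition is_irr_character (f : {ffun Iso1 n -> C}) : Prop :=
  exists d (rG : mx_representation C G d),
    mx_irreducible rG /\ forall g, f g = \tr (rG g).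

Definition enumerates_irr_characters K (chi : 'I_K -> {ffun Iso1 n -> C}) :=
  injective chi /\ forall f, is_irr_character f <-> exists k, f = chi k.

Definition epsilon_mx (f : {ffun Iso1 n -> C}) : 'M[C]_N :=
  (f 1%g / (2 * n`!)%N%:R) *: \sum_(g : Iso1 n) f g *: hat_mx g.

(* The row space of Wmx f consists of the transposes of the vectors in the
   range of epsilon_mx f. *)
Definition Wmx (f : {ffun Iso1 n -> C}) : 'M[C]_N := (epsilon_mx f)^T.

Definition has_multiplicity (f : {ffun Iso1 n -> C}) (m : nat) : Prop :=
  exists V : 'I_m -> 'M[C]_N,
    [/\ forall i, mxsimple hat_repr (V i),
        forall i j, mx_iso hat_repr (V i) (V j),
        forall i, (\rank (V i))%:R = f 1%g,
        mxdirect (\sum_i V i)%MS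
      & (\sum_i V i :=: Wmx f)%MS].

Definition frakB_orbit (v : 'cV[C]_N) : {vspace 'cV[C]_N} :=
  (linfun (mulmxr v : 'M[C]_N -> 'cV[C]_N) @: frakB)%VS.

Definition inner d (x y : 'cV[C]_d) : C := dotmx x^T y^T.
Definition norm2 d (x : 'cV[C]_d) : C := sqrtC (inner x x).

Definition orthogonal_basis d (U : {vspace 'cV[C]_d}) m
    (u : m.-tuple 'cV[C]_d) : Prop :=
  basis_of U u /\ forall j l, j != l -> inner (tnth u j) (tnth u l) = 0.

Definition basic_block m (u : m.-tuple 'cV[C]_N) (w : {set 'S_n * 'S_n}) :
    'M[C]_m :=
  \matrix_(j, l) (inner (orbit_mx w *m tnth u j) (tnth u l)
                  / (norm2 (tnth u j) * norm2 (tnth u l))).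

End OverC.

(* The direct sum of the full matrix algebras of sizes p k, realized as
   block-diagonal matrices; a block with p k = 0 is empty. *)
Definition block_diagonal (C : numClosedFieldType) K (p : 'I_K -> nat)
    (X : 'M[C]_(\sum_k p k)) : Prop :=
  exists Y : forall k, 'M[C]_(p k), X = \mxdiag_k Y k.

Definition adjoint_mx (C : numClosedFieldType) d (X : 'M[C]_d) : 'M[C]_d :=
  (map_mx Num.conj X)^T.

(* kappa is a linear map on the whole matrix space; only its restriction to A
   matters, and every linear map defined on A extends. *)
Definition star_isomorphism (C : numClosedFieldType) d e
    (A : {vspace 'M[C]_d}) (B : 'M[C]_e -> Prop)
    (kappa : {linear 'M[C]_d -> 'M[C]_e}) : Prop :=
  [/\ {in A &, injective kappa},
      forall Y, B Y <-> exists2 X, X \in A & kappa X = Y,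
      {in A &, forall X Y, kappa (X *m Y) = kappa X *m kappa Y}
    & {in A, forall X, kappa (adjoint_mx X) = adjoint_mx (kappa X)}].

Definition star_isomorphic (C : numClosedFieldType) d e
    (A : {vspace 'M[C]_d}) (B : 'M[C]_e -> Prop) : Prop :=
  exists kappa, star_isomorphism A B kappa.

Definition unital_subalgebra (C : numClosedFieldType) d
    (S : {vspace 'M[C]_d}) : Prop :=
  1%:M \in S /\ {in S &, forall X Y, X *m Y \in S}.

(* B is the least unital subalgebra of the matrix algebra containing gens. *)
Definition generated_by (C : numClosedFieldType) d
    (B : 'M[C]_d -> Prop) (gens : 'M[C]_d -> Prop) : Prop :=
  forall X, B X <->
    forall S : {vspace 'M[C]_d}, unital_subalgebra S ->
      (forall Z, gens Z -> Z \in S) -> X \in S.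

(* Main.v *)
Require Import Defs.
From HB Require Import structures.
From mathcomp Require Import all_boot all_order all_fingroup all_algebra.
From mathcomp Require Import all_solvable all_character.
From mathcomp Require Import complex reals.

(* By the Schur relations the matrices epsilon_k are orthogonal idempotents of
   sum 1, and frakB is the commutant of the matrices hat g.  An isomorphism of
   W_k with a sum of m copies of an irreducible module amounts to intertwiners
   R_i (from the module to C^N) and D_j (back) with R_i D_j = delta_ij and
   \sum_i D_i R_i = epsilon_k.  By Schur's lemma R_i Y D_j is a scalar y_ij for
   every Y in the commutant, and Y |-> (y_ij) maps onto the full matrix algebra,
   since D_i R_j is in the commutant.  The frakB-orbit of v_k contains all
   s R_j for some nonzero s, so when it has dimension m these form a basis of it
   and the orthonormalization of (u_j) is Q^-1 (s R_j)_j for some invertible Q: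
   the basic block of Y is then Q^-1 (y_ij) Q.  Row vectors are used, as in the
   library, so X in frakB acts through Y = X^T; hence X |-> block X reverses
   products and the *-isomorphism is its transpose.  As the orbit matrices span
   frakB, their diagonal joins even span the block diagonal matrices. *)

Set Implicit Arguments.
Unset Strict Implicit.
Unset Printing Implicit Defensive.

Import GRing.Theory Num.Theory.
Local Open Scope ring_scope.

(** * Schur relations *)

Section Irreducible.

Variables (C : numClosedFieldType) (gT : finGroupType) (G : {group gT}).

Lemma mx_Schur_scalar d (rG : mx_representation C G d) (M : 'M[C]_d) :
  mx_irreducible rG -> {in G, forall g, M *m rG g = rG g *m M} ->
  exists c, M = c%:M.
Proof.
move=> irrG cM; apply/is_scalar_mxP.
apply: (@mx_abs_irr_cent_scalar _ _ _ _ rG).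
  exact: group_closure_closed_field.
by apply/centgmxP.
Qed.

(** The kernel of [M] is a submodule of [rG] other than the whole space, hence zero; the row space
    of [M] is a nonzero submodule of [rH], hence everything. *)
Lemma mx_Schur_neq0 d e (rG : mx_representation C G d)
    (rH : mx_representation C G e) (M : 'M[C]_(d, e)) :
  mx_irreducible rG -> mx_irreducible rH ->
  {in G, forall g, rG g *m M = M *m rH g} -> M != 0 -> mx_rsim rG rH.
Proof.
move=> /mx_irrP[_ irrG] /mx_irrP[_ irrH] homM nzM.
have freeM : row_free M.
  rewrite -kermx_eq0; apply: contraNT nzM => nzK.
  have modK : mxmodule rG (kermx M).
    apply/mxmoduleP=> g Gg; apply/sub_kermxP.
    by rewrite -mulmxA homM // mulmxA mulmx_ker mul0mx.
  have /row_fullP[K' K'K] := irrG _ modK nzK.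
  by rewrite -[M]mul1mx -K'K -mulmxA mulmx_ker mulmx0.
have modI : mxmodule rH <<M>>%MS.
  apply/mxmoduleP=> g Gg.
  by rewrite (eqmxMr _ (genmxE _)) genmxE -homM // submxMl.
have fullM : row_full M.
  have /= := irrH _ modI; rewrite -mxrank_eq0 /row_full !genmxE mxrank_eq0.
  by apply.
exists M => //; apply/eqP; move: freeM fullM; rewrite /row_free /row_full.
by move=> /eqP eqd /eqP eqe; rewrite -{1}eqd eqe.
Qed.

Lemma dual_mx_repr d (rG : mx_representation C G d) :
  mx_repr G (fun g => (rG g^-1%g)^T).
Proof.
split=> [|g h Gg Gh]; first by rewrite invg1 repr_mx1 trmx1.
by rewrite invMg repr_mxM ?groupV // trmx_mul.
Qed.

Definition dual_repr d (rG : mx_representation C G d) :=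
  MxRepresentation (dual_mx_repr rG).

(** The annihilator of a dual submodule [U], here [kermx U^T], is a submodule for [rG]. It is
    therefore zero or full, which makes [U] full or zero respectively. *)
Lemma dual_repr_irr d (rG : mx_representation C G d) :
  mx_irreducible rG -> mx_irreducible (dual_repr rG).
Proof.
move=> /mx_irrP[d_gt0 irrG]; apply/mx_irrP; split=> // U modU nzU.
pose K := kermx U^T.
have modK : mxmodule rG K.
  apply/mxmoduleP=> g Gg; apply/sub_kermxP.
  have /submxP[D defD] : (U *m (rG g)^T <= U)%MS.
    by have := mxmoduleP modU g^-1%g; rewrite /= invgK groupV => /(_ Gg).
  rewrite -mulmxA -[rG g *m _]trmxK trmx_mul trmxK defD trmx_mul.
  by rewrite mulmxA mulmx_ker mul0mx.
have [K0|/(irrG _ modK) fullK] := eqVneq K 0.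
  by have := mxrank_ker U^T; rewrite -/K K0 mxrank0 mxrank_tr => /esym/eqP;
    rewrite subn_eq0 -col_leq_rank.
have /row_fullP[K' K'K] := fullK; case/negP: nzU.
by rewrite -trmx_eq0 -[U^T]mul1mx -K'K -mulmxA mulmx_ker mulmx0.
Qed.

Lemma sum_intertwiner d e (rG : mx_representation C G d)
    (rH : mx_representation C G e) (M : 'M[C]_(d, e)) :
  let S := \sum_(g in G) rG g^-1%g *m M *m rH g in
  {in G, forall h, rG h *m S = S *m rH h}.
Proof.
move=> S h Gh; rewrite mulmx_sumr mulmx_suml.
rewrite (reindex_acts 'R _ Gh) ?astabsR //=; apply: eq_bigr => g Gg.
rewrite !mulmxA invMg -repr_mxM ?groupM ?groupV // mulgA mulgV mul1g.
by rewrite repr_mxM // !mulmxA.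
Qed.

Lemma mul_mx_delta_mxE m p q r (A : 'M[C]_(m, p)) (B : 'M[C]_(q, r)) a b i j :
  (A *m delta_mx a b *m B) i j = A i a * B b j.
Proof.
rewrite -(mul_delta_mx (0 : 'I_1)) mulmxA -colE -mulmxA -rowE mxE big_ord1.
by rewrite !mxE.
Qed.

Lemma mxtrace_delta d (i j : 'I_d) : \tr (delta_mx i j : 'M[C]_d) = (i == j)%:R.
Proof.
rewrite /mxtrace (bigD1 i) //= big1 ?addr0 => [|k /negPf k_i].
  by rewrite mxE eqxx.
by rewrite mxE k_i.
Qed.

(** Averaging any [M] gives an intertwiner from the dual of [rG] to [rH], which is zero by Schur's
    lemma. For [M = delta_mx k i] its entry [(k, j)] is the sum over [g] of [rG g k k * rH g i j],
    and summing over [k] produces the trace. *)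
Lemma sum_mxtrace_repr_neq d e (rG : mx_representation C G d)
    (rH : mx_representation C G e) :
  mx_irreducible rG -> mx_irreducible rH -> ~ mx_rsim (dual_repr rG) rH ->
  \sum_(g in G) \tr (rG g) *: rH g = 0.
Proof.
move=> irrG irrH nsim.
have ort (M : 'M[C]_(d, e)) : \sum_(g in G) (rG g)^T *m M *m rH g = 0.
  have /= := @sum_intertwiner _ _ (dual_repr rG) rH M.
  under eq_bigr => g do rewrite invgK.
  move=> hom; apply/eqP; apply/negPn/negP => nz; apply: nsim.
  by apply: mx_Schur_neq0 nz => //; apply: dual_repr_irr.
apply/matrixP=> i j; rewrite summxE mxE.
under eq_bigr => g _ do rewrite mxE /mxtrace mulr_suml.
rewrite exchange_big big1 //= => k _.
have /matrixP/(_ k j) := ort (delta_mx k i); rewrite summxE mxE => ort_ki.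
rewrite -[RHS]ort_ki.
by apply: eq_bigr => g _; rewrite mul_mx_delta_mxE mxE.
Qed.

(** Here the average of [M] commutes with [rG], so it is a scalar, and comparing traces gives its
    value. The averages of the [delta_mx k i] are then read off entrywise and summed over [k]. *)
Lemma sum_mxtrace_repr_dual d (rG : mx_representation C G d) :
  mx_irreducible rG ->
  \sum_(g in G) \tr (rG g^-1%g) *: rG g = (#|G|%:R / d%:R)%:M.
Proof.
move=> irrG; have d_gt0 : (0 < d)%N by case/mx_irrP: irrG.
have d_neq0 : d%:R != 0 :> C by rewrite pnatr_eq0 -lt0n.
have ort (M : 'M[C]_d) :
    \sum_(g in G) rG g^-1%g *m M *m rG g = (#|G|%:R / d%:R * \tr M)%:M.
  have [c defc] : exists c, \sum_(g in G) rG g^-1%g *m M *m rG g = c%:M.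
    by apply: mx_Schur_scalar irrG _ => g Gg; rewrite -sum_intertwiner.
  rewrite defc; congr _%:M.
  have := congr1 mxtrace defc; rewrite mxtrace_scalar raddf_sum /=.
  under eq_bigr => g Gg.
    rewrite mxtrace_mulC mulmxA -repr_mxM ?groupV // mulgV repr_mx1 mul1mx.
    over.
  rewrite sumr_const => tr_c; rewrite mulrAC [_ * \tr M]mulr_natl tr_c.
  by rewrite -[c *+ d]mulr_natr mulfK.
apply/matrixP=> i j; rewrite summxE.
under eq_bigr => g _ do rewrite mxE /mxtrace mulr_suml.
rewrite exchange_big /=.
transitivity (\sum_(k < d) (#|G|%:R / d%:R * (k == i)%:R)%:M k j : C).
  apply: eq_bigr => k _; have /matrixP/(_ k j) := ort (delta_mx k i).
  rewrite summxE mxtrace_delta eq_sym => <-.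
  by apply: eq_bigr => g _; rewrite mul_mx_delta_mxE.
rewrite (bigD1 i) //= big1 ?addr0 ?eqxx ?mulr1 // => k /negPf->.
by rewrite mulr0 !mxE mul0rn.
Qed.

End Irreducible.

(** * Isotypic projections *)

Section Isotypic.

Variables (C : numClosedFieldType) (n K : nat).
Variables (chi : 'I_K -> {ffun Iso1 n -> C}).
Hypothesis chi_irr : enumerates_irr_characters chi.

Local Notation G := [set: Iso1 n].
Local Notation N := (nperm n).
Local Notation rG := (hat_repr C n).

Lemma WmxE (f : {ffun Iso1 n -> C}) :
  Wmx f = (f 1%g / (2 * n`!)%N%:R) *: \sum_(g in G) f g *: rG g.
Proof.
rewrite /Wmx /epsilon_mx !linearZ /= linear_sum /=; congr (_ *: _).
by apply: eq_big => g; rewrite ?inE // => _; rewrite linearZ.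
Qed.

Lemma card_Iso1 : #|G| = (2 * n`!)%N.
Proof. by rewrite cardsT card_prod !card_ord mulnC card_Sn. Qed.

(** The coefficients of epsilon are [f g] and not [f g^-1], so the index [k] that fixes [U] is that
    of the character of the dual of [U]. The Schur relations give the scalar 1 for this [k] and 0
    for all others. *)
Lemma mulmx_Wmx_simple (U : 'M[C]_N) : mxsimple rG U ->
  exists k, forall l, U *m Wmx (chi l) = if l == k then U else 0.
Proof.
move=> simU; have modU : mxmodule rG U by case: simU.
pose B := submod_repr modU; have irrB : mx_irreducible B by apply/submod_mx_irr.
have d_gt0 : (0 < \rank U)%N by case/mx_irrP: irrB.
have /chi_irr.2[k defk] : is_irr_character [ffun g => \tr (B g^-1%g)].
  exists _, (dual_repr B); split; first exact: dual_repr_irr.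
  by move=> g; rewrite ffunE /= mxtrace_tr.
have baseW (f : {ffun Iso1 n -> C}) : row_base U *m Wmx f =
    (f 1%g / (2 * n`!)%N%:R) *: (\sum_(g in G) f g *: B g) *m row_base U.
  rewrite WmxE -scalemxAr -scalemxAl; congr (_ *: _).
  rewrite mulmx_sumr mulmx_suml; apply: eq_bigr => g Gg.
  rewrite -scalemxAr -scalemxAl; congr (_ *: _).
  have := val_submodJ modU 1%:M Gg.
  by rewrite /val_submod /= !mul1mx.
have /submxP[D defU] : (U <= row_base U)%MS by rewrite eq_row_base.
exists k => l; rewrite {1}defU -mulmxA baseW; have [->|l_k] := eqVneq l k.
  rewrite -defk ffunE invg1 repr_mx1 mxtrace1.
  under eq_bigr => g _ do rewrite ffunE.
  rewrite sum_mxtrace_repr_dual // card_Iso1 scale_scalar_mx.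
  rewrite mulrA divfK ?mulfV ?mul1mx -?defU // pnatr_eq0 -?lt0n //.
  by rewrite muln_gt0 fact_gt0.
have [d [A [irrA chiA]]] : is_irr_character (chi l).
  by apply/chi_irr.2; exists l.
under eq_bigr => g _ do rewrite chiA.
rewrite sum_mxtrace_repr_neq ?scaler0 ?mul0mx ?mulmx0 // => simAB.
case/eqP: l_k; apply: chi_irr.1; rewrite -defk; apply/ffunP=> g.
rewrite ffunE -(mxtrace_rsim simAB) ?inE //= invgK mxtrace_tr.
exact: chiA.
Qed.

(** By Maschke's theorem the whole space is a sum of simple submodules. Identities between the
    projections thus reduce to [mulmx_Wmx_simple]. *)
Lemma hat_repr_eq (X Y : 'M[C]_N) :
  (forall U, mxsimple rG U -> U *m X = U *m Y) -> X = Y.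
Proof.
move=> eqXY; apply/eqP; rewrite -subr_eq0.
apply: (mx_reducible_semisimple (mxmodule1 rG)) => [|[I U W simU defW _]].
  apply: mx_Maschke_pchar; rewrite /pgroup pcharf'_nat pnatr_eq0 -lt0n.
  by rewrite cardG_gt0.
rewrite -[X - Y]mul1mx; apply/eqP/sub_kermxP.
suff : (W <= kermx (X - Y))%MS by rewrite defW.
apply/sumsmx_subP=> i _; apply/sub_kermxP.
by rewrite mulmxBr eqXY ?subrr.
Qed.

Lemma mulmx_Wmx k l :
  Wmx (chi k) *m Wmx (chi l) = if k == l then Wmx (chi k) else 0.
Proof.
apply: hat_repr_eq => U /mulmx_Wmx_simple[j Wj]; rewrite mulmxA !Wj.
have [-> | k_j] := eqVneq k j.
  by rewrite Wj eq_sym; case: eqP; rewrite ?Wj ?eqxx ?mulmx0.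
by rewrite mul0mx; case: eqP; rewrite ?Wj ?(negPf k_j) ?mulmx0.
Qed.

Lemma sum_Wmx : \sum_k Wmx (chi k) = 1%:M.
Proof.
apply: hat_repr_eq => U /mulmx_Wmx_simple[j Wj]; rewrite mulmx_sumr mulmx1.
rewrite (bigD1 j) //= Wj eqxx big1 ?addr0 // => l /negPf l_j.
by rewrite Wj l_j.
Qed.

Lemma Wmx_comm k (Y : 'M[C]_N) :
  (forall g, rG g *m Y = Y *m rG g) -> Wmx (chi k) *m Y = Y *m Wmx (chi k).
Proof.
move=> cY; rewrite WmxE -scalemxAl -scalemxAr; congr (_ *: _).
rewrite mulmx_suml mulmx_sumr; apply: eq_bigr => g _.
by rewrite -scalemxAl -scalemxAr cY.
Qed.

Lemma Wmx_class k g : rG g *m Wmx (chi k) = Wmx (chi k) *m rG g.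
Proof.
apply: hat_repr_eq => U simU; have [j Wj] := mulmx_Wmx_simple simU.
have modU : mxmodule rG U by case: simU.
have /submxP[D defD] : (U *m rG g <= U)%MS.
  by apply: (mxmoduleP modU); rewrite inE.
by rewrite !mulmxA defD -mulmxA !Wj; case: eqP; rewrite ?mul0mx ?mulmx0.
Qed.

End Isotypic.

(** * Matrix units of an isotypic component *)

Section Frame.

Variables (C : numClosedFieldType) (n K : nat).
Variables (chi : 'I_K -> {ffun Iso1 n -> C}).
Hypothesis chi_irr : enumerates_irr_characters chi.

Local Notation N := (nperm n).
Local Notation rG := (hat_repr C n).

(** The rows of [R i] are a basis of the i-th simple copy and [D j] takes coordinates in the j-th.
    Irreducibility of [A] is recorded only as the conclusion of Schur's lemma, so that [d = 0] can
    serve when [m = 0]. *)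
Definition isotypic_frame (W : 'M[C]_N) m d (A : Iso1 n -> 'M[C]_d)
    (R : 'I_m -> 'M[C]_(d, N)) (D : 'I_m -> 'M[C]_(N, d)) :=
  [/\ forall L, (forall g, L *m A g = A g *m L) -> exists c, L = c%:M,
      forall i g, R i *m rG g = A g *m R i,
      forall i g, rG g *m D i = D i *m A g,
      forall i j, R i *m D j = (i == j)%:R%:M
    & \sum_i D i *m R i = W].

Lemma isotypic_frame_exists k m : has_multiplicity (chi k) m ->
  exists d (A : Iso1 n -> 'M[C]_d) (R : 'I_m -> 'M[C]_(d, N)) D,
    isotypic_frame (Wmx (chi k)) A R D.
Proof.
case: m => [|m] [V [simV isoV _ dxV defW]].
  exists 0, (fun=> 0), (fun=> 0), (fun=> 0); split=> //.
  - by move=> L _; exists 0; rewrite !thinmx0.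
  - by move=> i g; rewrite mul0mx mulmx0.
  - by move=> i g; rewrite mul0mx mulmx0.
  - by case.
  by rewrite big_ord0; apply/esym/eqP; rewrite -submx0 -defW big_ord0.
have modV i : mxmodule rG (V i) by case: (simV i).
pose A := submod_repr (modV ord0).
have irrA : mx_irreducible A by apply/submod_mx_irr.
(* One basis of [V ord0] is carried to every [V i] by an isomorphism, so that the group acts on all
   copies by the same matrices [A g]. *)
have R_exists i : exists Ri : 'M[C]_(\rank (V ord0), N),
    [/\ (Ri :=: V i)%MS, row_free Ri & forall g, Ri *m rG g = A g *m Ri].
  have [f unitf homf imf] := isoV ord0 i.
  have baseV := eq_row_base (V ord0).
  exists (row_base (V ord0) *m f); split=> [||g].
  - by apply: eqmx_trans imf; apply: eqmxMr.
  - rewrite /row_free mxrankMfree ?row_free_unit //.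
    exact: row_base_free.
  have /hom_mxP homR : (row_base (V ord0) <= dom_hom_mx rG f)%MS.
    by rewrite baseV.
  rewrite -homR ?inE // mulmxA; congr (_ *m f).
  have := val_submodJ (modV ord0) 1%:M (in_setT g).
  by rewrite /val_submod /= !mul1mx.
have {R_exists} [R RP] := fin_all_exists R_exists.
(* [D j] projects to the component, then to [V j] along the other summands, and finally takes
   coordinates with respect to the basis [R j]. *)
pose P j := proj_mx (V j) (\sum_(i | i != j) V i)%MS.
pose D j := Wmx (chi k) *m P j *m pinvmx (R j).
have dxV0 j : (V j :&: \sum_(i | i != j) V i = 0)%MS.
  by have /mxdirect_sumsP/(_ j isT) := dxV.
have idW : Wmx (chi k) *m Wmx (chi k) = Wmx (chi k).
  by rewrite (mulmx_Wmx chi_irr) eqxx.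
clearbody A.
have RW i : R i *m Wmx (chi k) = R i.
  have /submxP[E ->] : (R i <= Wmx (chi k))%MS.
    by case: (RP i) => -> _ _; rewrite -defW (sumsmx_sup i).
  by rewrite -mulmxA idW.
have RD i j : R i *m D j = (i == j)%:R%:M.
  have [defR freeR _] := RP i; rewrite /D /P 2!mulmxA RW.
  have [<- | i_j] := eqVneq i j.
    by rewrite proj_mx_id ?dxV0 ?defR ?mulmxVp.
  rewrite proj_mx_0 ?dxV0 //; last by rewrite defR (sumsmx_sup i).
  by rewrite mul0mx mulr0n raddf0.
(* [D i *m R i] is [Wmx (chi k) *m P i], because the rows of [P i] lie in the span of [R i]; on the
   component the [P i] sum to the identity. *)
have sumDR : \sum_i D i *m R i = Wmx (chi k).
  transitivity (Wmx (chi k) *m \sum_i P i).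
    rewrite mulmx_sumr; apply: eq_bigr => i _; rewrite mulmxKpV //.
    by case: (RP i) => -> _ _; apply: proj_mx_sub.
  apply/eqP; rewrite -subr_eq0 -[X in _ - X]mulmx1 -mulmxBr.
  apply/eqP/sub_kermxP; rewrite -defW; apply/sumsmx_subP=> i _.
  apply/sub_kermxP; rewrite mulmxBr mulmx1 mulmx_sumr /P (bigD1 i) //=.
  rewrite proj_mx_id // big1 ?addr0 ?subrr // => j j_i.
  by rewrite proj_mx_0 // (sumsmx_sup i) // eq_sym.
have WD j : Wmx (chi k) *m D j = D j by rewrite /D 2!mulmxA idW.
clearbody D; exists _, A, R, D; split=> // [L cL | i g | j g].
- by apply: (mx_Schur_scalar irrA) => g _; apply: cL.
- by case: (RP i).
(* That [D j] intertwines is deduced from the other relations: insert the central projection, expand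
   it as the sum of the [D i *m R i], and move [g] across [R i]; only the term [i = j] survives. *)
rewrite -{1}WD mulmxA (Wmx_class chi_irr) -mulmxA -sumDR mulmx_suml.
rewrite (bigD1 j) //= big1 => [|i /negPf i_j]; last first.
  by case: (RP i) => _ _ hR; rewrite mulmxA -(mulmxA _ (R i)) hR
    -!mulmxA RD i_j mulr0n raddf0 !mulmx0.
case: (RP j) => _ _ hR; rewrite addr0 mulmxA -(mulmxA _ (R j)) hR.
by rewrite -!mulmxA RD eqxx mulmx1.
Qed.

End Frame.

(** * The commutant *)

Section Commutant.

Variables (C : numClosedFieldType) (n : nat).

Local Notation N := (nperm n).
Local Notation rG := (hat_repr C n).

Definition iso1_idx (g : Iso1 n) (i : 'I_N) : 'I_N :=
  enum_rank (iso1_action n (enum_val i) g).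

Lemma mulmx_hat (X : 'M[C]_N) g i j :
  (X *m hat_mx C g) i j = X i (iso1_idx g j).
Proof.
rewrite mxE (bigD1 (iso1_idx g j)) //= big1 => [|k /negPf k_j].
  by rewrite mxE enum_rankK eqxx mulr1 addr0.
by rewrite mxE (can2_eq enum_valK enum_rankK) k_j mulr0.
Qed.

Lemma hat_mulmx (X : 'M[C]_N) g i j :
  (hat_mx C g *m X) (iso1_idx g i) j = X i j.
Proof.
rewrite mxE (bigD1 i) //= big1 => [|k /negPf k_i].
  by rewrite mxE enum_rankK eqxx mul1r addr0.
rewrite mxE enum_rankK (inj_eq (act_inj (iso1_action n) g)).
by rewrite (inj_eq enum_val_inj) eq_sym k_i mul0r.
Qed.

Lemma hat_mx_commP (X : 'M[C]_N) :
  (forall g, rG g *m X^T = X^T *m rG g) <->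
  (forall g i j, X (iso1_idx g i) (iso1_idx g j) = X i j).
Proof.
split=> [cX g i j | cX g].
  have /(congr1 trmx) := cX g; rewrite /= !trmx_mul !trmxK => cXg.
  by rewrite -mulmx_hat cXg hat_mulmx.
rewrite /= -!trmx_mul; congr _^T; apply/matrixP=> i j.
have -> : i = iso1_idx g (iso1_idx g^-1 i).
  by rewrite /iso1_idx enum_rankK actKV enum_valK.
by rewrite mulmx_hat hat_mulmx cX.
Qed.

Lemma orbit_mx_invariant w g i j : w \in iso1_orbits n ->
  orbit_mx C w (iso1_idx g i) (iso1_idx g j) = orbit_mx C w i j.
Proof.
case/imsetP=> x _ ->; rewrite !mxE; congr (nat_of_bool _)%:R.
rewrite !enum_rankK -[RHS](orbit_actr (iso1_diag_action n) _ _ (in_setT g)).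
by [].
Qed.

Lemma invariant_orbit_sum (X : 'M[C]_N) :
  (forall g i j, X (iso1_idx g i) (iso1_idx g j) = X i j) ->
  exists c, X = \sum_(w in iso1_orbits n) c w *: orbit_mx C w.
Proof.
(* The coefficient of an orbit is the entry of [X] at a representative; orbits are nonempty, so the
   default pair is never reached. *)
move=> cX; pose r (w : {set 'S_n * 'S_n}) := odflt (1%g, 1%g) [pick x in w].
exists (fun w => X (enum_rank (r w).1) (enum_rank (r w).2)).
apply/matrixP=> i j; rewrite summxE; set x := (enum_val i, enum_val j).
pose w0 := orbit (iso1_diag_action n) [set: Iso1 n] x.
have w0_orb : w0 \in iso1_orbits n by apply: imset_f.
have w0x : x \in w0 by apply: orbit_refl.
rewrite (bigD1 w0) //= big1 => [|w /andP[/imsetP[y _ ->]] w_w0]; last first.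
  rewrite !mxE -/x; case: (boolP (x \in _)) => [yx|]; last by rewrite mulr0.
  by case/eqP: w_w0; apply/esym/orbit_eqP.
rewrite !mxE -/x w0x mulr1 addr0 /r.
case: pickP => [y /orbitP[g _ <-]|/(_ x)] /=; last by rewrite w0x.
exact/esym/cX.
Qed.

(** Commuting with the permutation matrices means having entries constant along the diagonal orbits,
    whose indicators are the orbit matrices. *)
Lemma frakBP (X : 'M[C]_N) :
  X \in frakB C n <-> (forall g, rG g *m X^T = X^T *m rG g).
Proof.
rewrite hat_mx_commP; split=> [|cX].
  rewrite /frakB => /coord_span -> g i j.
  rewrite !summxE; apply: eq_bigr => k _.
  rewrite [LHS]mxE [RHS]mxE; congr (_ * _).
  set Y := _`_k; have : Y \in [seq orbit_mx C w | w <- enum (iso1_orbits n)].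
    by rewrite mem_nth // size_map -cardE.
  by case/mapP=> w; rewrite mem_enum => w_orb ->; apply: orbit_mx_invariant.
have [c ->] := invariant_orbit_sum cX.
apply: memv_suml => w w_orb; apply/memvZ/memv_span.
by apply/mapP; exists w; rewrite ?mem_enum.
Qed.

End Commutant.

(** * Basic blocks *)

Section Block.

Local Open Scope sesquilinear_scope.

Variables (C : numClosedFieldType) (n : nat).

Local Notation N := (nperm n).
Local Notation rG := (hat_repr C n).

Definition normalized_mx m (u : m.-tuple 'cV[C]_N) : 'M[C]_(m, N) :=
  \matrix_(j < m) ((norm2 (tnth u j))^-1 *: (tnth u j)^T).

Lemma norm2_neq0 d (x : 'cV[C]_d) : x != 0 -> norm2 x != 0.
Proof. by rewrite sqrtC_eq0 dnorm_eq0 trmx_eq0. Qed.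

Lemma norm2_conj d (x : 'cV[C]_d) : (norm2 x)^* = norm2 x.
Proof. by apply/CrealP/ger0_real; rewrite sqrtC_ge0; apply: dnorm_ge0. Qed.

Lemma dotmx_normalize d (x y : 'cV[C]_d) (z t : 'rV[C]_d) :
  dotmx ((norm2 x)^-1 *: z) ((norm2 y)^-1 *: t) =
    (norm2 x)^-1 * (norm2 y)^-1 * dotmx z t.
Proof.
rewrite !dotmxE linearZ map_mxZ /= fmorphV [_ (norm2 y)]norm2_conj.
by rewrite -scalemxAl -scalemxAr scalerA mxE.
Qed.

Lemma mul_adjmxE m p q (A : 'M[C]_(m, q)) (B : 'M[C]_(p, q)) j l :
  (A *m B^t*) j l = dotmx (row j A) (row l B).
Proof. by rewrite dotmxE !mxE; apply: eq_bigr => i _; rewrite !mxE. Qed.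

Lemma basic_blockE m (u : m.-tuple 'cV[C]_N) w :
  basic_block u w =
    normalized_mx u *m (orbit_mx C w)^T *m (normalized_mx u)^t*.
Proof.
apply/matrixP=> j l; rewrite mul_adjmxE row_mul !rowK mxE /inner trmx_mul.
by rewrite -scalemxAl dotmx_normalize invfM mulrC.
Qed.

Lemma normalized_mx_unitary m (u : m.-tuple 'cV[C]_N) U :
  orthogonal_basis U u -> normalized_mx u \is unitarymx.
Proof.
case=> basis_u ortho; apply/row_unitarymxP=> j l; rewrite !rowK dotmx_normalize.
have [<- | j_l] := eqVneq j l; last by rewrite [dotmx _ _]ortho // mulr0.
have u_neq0 : norm2 (tnth u j) != 0.
  apply/norm2_neq0/(free_not0 (basis_free basis_u)); exact: mem_tnth.
rewrite -invfM -expr2 sqrtCK mulVf //.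
by move: u_neq0; rewrite sqrtC_eq0.
Qed.

(** The extension of the basic block from orbit matrices to all [X], in the form found in
    [basic_blockE]. *)
Definition block_of m (u : m.-tuple 'cV[C]_N) (X : 'M[C]_N) : 'M[C]_m :=
  normalized_mx u *m X^T *m (normalized_mx u)^t*.

(** * Coordinates of the commutant on one isotypic component *)

Section Frame.

Variables (W : 'M[C]_N) (m d : nat) (A : Iso1 n -> 'M[C]_d).
Variables (R : 'I_m -> 'M[C]_(d, N)) (D : 'I_m -> 'M[C]_(N, d)).
Hypothesis frameW : isotypic_frame W A R D.

Lemma frame_idem : W *m W = W.
Proof.
have [_ _ _ RD defW] := frameW; rewrite -{2 3}defW mulmx_sumr.
apply: eq_bigr => j _; rewrite -defW mulmx_suml (bigD1 j) //=.
rewrite big1 => [|i /negPf i_j]; rewrite mulmxA -(mulmxA (D _)) RD.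
  by rewrite addr0 eqxx mulmx1.
by rewrite i_j raddf0 mulmx0 mul0mx.
Qed.

Lemma frame_RW i : R i *m W = R i.
Proof.
have [_ _ _ RD <-] := frameW; rewrite mulmx_sumr (bigD1 i) //=.
rewrite big1 => [|j]; first by rewrite mulmxA RD eqxx mul1mx addr0.
by rewrite eq_sym mulmxA RD => /negPf->; rewrite raddf0 mul0mx.
Qed.

Lemma frame_coefs (X : 'M[C]_N) : X \in frakB C n ->
  exists y : 'M[C]_m, forall i j, R i *m X^T *m D j = (y i j)%:M.
Proof.
move=> /frakBP cX; have [schur RA AD _ _] := frameW.
have /fin_all_exists[y yP] i : exists y_i : {ffun 'I_m -> C},
    forall j, R i *m X^T *m D j = (y_i j)%:M.
  have /fin_all_exists[y_i yP] j : exists c, R i *m X^T *m D j = c%:M.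
    apply: schur => g; rewrite -mulmxA -AD !mulmxA -(mulmxA (R i)) -cX.
    by rewrite !mulmxA RA.
  by exists (finfun y_i) => j; rewrite ffunE.
by exists (\matrix_(i, j) y i j) => i j; rewrite mxE.
Qed.

(** The matrix units of the commutant on this component, transposed because [X] acts on row vectors
    through [X^T]. *)
Definition frame_unit i j := (D i *m R j)^T.

Lemma frame_unit_frakB i j : frame_unit i j \in frakB C n.
Proof.
apply/frakBP=> g; have [_ RA AD _ _] := frameW.
by rewrite trmxK mulmxA AD -!mulmxA RA.
Qed.

Lemma frame_normalized v (u : m.-tuple 'cV[C]_N) :
  (0 < m)%N -> (v^T <= W)%MS ->
  \dim (frakB_orbit v) = m -> orthogonal_basis (frakB_orbit v) u ->
  exists (s : 'rV[C]_d) (Q : 'M[C]_m),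
    Q \in unitmx /\ \matrix_i (s *m R i) = Q *m normalized_mx u.
Proof.
move=> m_gt0 vW dimU uP; have [_ _ _ RD defW] := frameW.
have vWv : v^T *m W = v^T.
  by have /submxP[a ->] := vW; rewrite -mulmxA frame_idem.
(* If every [v^T *m D i] vanished, then so would [v] and its orbit, whose dimension is [m > 0]. *)
have [i0 s_neq0] : exists i, v^T *m D i != 0.
  apply/existsP; apply: contraLR m_gt0; rewrite negb_exists => /forallP vD0.
  rewrite -eqn0Ngt -dimU dimv_eq0 -subv0; apply/subvP => _ /memv_imgP[X _ ->].
  rewrite lfunE /= -[v]trmxK -vWv -defW mulmx_sumr big1 ?trmx0 ?mulmx0 //.
    exact: mem0v.
  move=> i _; have /negPn/eqP v0 := vD0 i.
  by rewrite mulmxA v0 mul0mx.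
pose s := v^T *m D i0; exists s.
pose B := \matrix_(i < m) (s *m R i).
have freeB : row_free B.
  (* The vectors [s *m R i] are independent: pairing them with [D j *m pinvmx s] gives the identity
     matrix. *)
  have /mulmxVp st : row_free s by rewrite /row_free rank_rV s_neq0.
  apply/row_freeP; exists (\matrix_(i, j) (D j *m pinvmx s) i 0).
  apply/matrixP=> i j; rewrite mxE.
  transitivity ((s *m R i *m (D j *m pinvmx s)) 0 0).
    by rewrite [RHS]mxE; apply: eq_bigr => k _; rewrite !mxE.
  rewrite mulmxA -(mulmxA s) RD mul_mx_scalar -scalemxAl st !mxE eqxx.
  by rewrite mulr1.
have [basis_u _] := uP.
have sBE : (B <= normalized_mx u)%MS.
  apply/row_subP=> i; rewrite rowK.
  have : (s *m R i)^T \in frakB_orbit v.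
    apply/memv_imgP; exists (frame_unit i0 i); first exact: frame_unit_frakB.
    by rewrite lfunE /=; apply: trmx_inj; rewrite trmxK trmx_mul trmxK mulmxA.
  move/(coord_basis basis_u)/(congr1 trmx); rewrite trmxK => ->.
  rewrite linear_sum /=; apply: summx_sub => j _; rewrite linearZ /=.
  apply: scalemx_sub; rewrite -tnth_nth.
  have u_neq0 : norm2 (tnth u j) != 0.
    apply/norm2_neq0/(free_not0 (basis_free basis_u)); exact: mem_tnth.
  rewrite -[X in (X <= _)%MS](scalerKV u_neq0).
  apply: scalemx_sub.
  by have := row_sub j (normalized_mx u); rewrite rowK.
have /submxP[Q defB] := sBE; exists Q; split=> //.
(* [Q] is square of size [m], and its rank is at least that of the product [B], which is [m]. *)
rewrite -row_free_unit /row_free eqn_leq rank_leq_row /=.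
by rewrite -{1}(eqP freeB) defB mxrankM_maxl.
Qed.

Hypothesis comW : forall X, X \in frakB C n -> W *m X^T = X^T *m W.

(** Since [X^T] commutes with [W], the product [R i *m X^T] can be followed by [W], which expands as
    the sum of the [D j *m R j]. *)
Lemma frame_act (X : 'M[C]_N) (y : 'M[C]_m) i : X \in frakB C n ->
  (forall i j, R i *m X^T *m D j = (y i j)%:M) ->
  R i *m X^T = \sum_j y i j *: R j.
Proof.
move=> XB yP; rewrite -{1}(frame_RW i) -mulmxA comW // mulmxA.
have [_ _ _ _ <-] := frameW; rewrite mulmx_sumr.
by apply: eq_bigr => j _; rewrite mulmxA yP mul_scalar_mx.
Qed.

Lemma block_conj v (u : m.-tuple 'cV[C]_N) :
  ((0 < m)%N -> (v^T <= W)%MS) ->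
  ((0 < m)%N -> \dim (frakB_orbit v) = m) ->
  ((0 < m)%N -> orthogonal_basis (frakB_orbit v) u) ->
  exists Q : 'M[C]_m,
  [/\ Q \in unitmx, normalized_mx u *m W = normalized_mx u
    & forall X (y : 'M[C]_m), X \in frakB C n ->
       (forall i j, R i *m X^T *m D j = (y i j)%:M) ->
       block_of u X = invmx Q *m y *m Q].
Proof.
have [m0 _ _ _|m_gt0 /(_ isT) vW /(_ isT) dimU /(_ isT) uP] := posnP m.
  (* For [m = 0] all the matrices involved have no rows, so every identity is trivial. *)
  have eq_mx p (M M' : 'M[C]_(m, p)) : M = M'.
    by apply/matrixP=> -[i lt_i_m]; exfalso; move: lt_i_m; rewrite m0.
  by exists 1%:M; split=> *; [apply: unitmx1 | apply: eq_mx | apply: eq_mx].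
have [s [Q [unitQ defQ]]] := frame_normalized m_gt0 vW dimU uP.
have defE : normalized_mx u = invmx Q *m \matrix_i (s *m R i).
  by rewrite defQ mulKmx.
exists Q; split=> // [|X y XB yP].
  rewrite defE -mulmxA; congr (_ *m _); apply/row_matrixP=> i.
  by rewrite row_mul !rowK -mulmxA frame_RW.
(* In the basis [s *m R i] the matrix of [X^T] is [y]. Passing to the orthonormal basis conjugates
   it by [Q], and the product of [normalized_mx u] with its adjoint is the identity. *)
have actX : \matrix_i (s *m R i) *m X^T = y *m \matrix_i (s *m R i).
  apply/row_matrixP=> i; rewrite !row_mul rowK -mulmxA (frame_act _ XB yP).
  rewrite mulmx_sumr; apply/rowP => k; rewrite summxE mxE.
  by apply: eq_bigr => j _; rewrite -scalemxAr !mxE.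
rewrite /block_of {1}defE -(mulmxA (invmx Q) _ X^T) actX defQ -!mulmxA.
by rewrite (unitarymxP (normalized_mx_unitary uP)) mulmx1.
Qed.

Lemma frame_coefs_mul (X X' : 'M[C]_N) (y y' : 'M[C]_m) :
  X \in frakB C n ->
  (forall i j, R i *m X^T *m D j = (y i j)%:M) ->
  (forall i j, R i *m X'^T *m D j = (y' i j)%:M) ->
  forall i j, R i *m (X' *m X)^T *m D j = ((y *m y') i j)%:M.
Proof.
move=> XB yP yP' i j; rewrite trmx_mul mulmxA (frame_act _ XB yP) !mulmx_suml.
rewrite mxE raddf_sum; apply: eq_bigr => k _ /=.
by rewrite -!scalemxAl yP' scale_scalar_mx.
Qed.

(** The combination of the matrix units with coefficients [z] works. The condition on [W] confines
    [X] to this component, so that its blocks in the other components will vanish. *)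
Lemma frame_lift (z : 'M[C]_m) :
  exists X, [/\ X \in frakB C n, W *m X^T = X^T
    & forall i j, R i *m X^T *m D j = (z i j)%:M].
Proof.
have [_ _ _ RD defW] := frameW.
pose X := \sum_i \sum_j z i j *: frame_unit i j.
have XT : X^T = \sum_i \sum_j z i j *: (D i *m R j).
  rewrite linear_sum; apply: eq_bigr => i _ /=; rewrite linear_sum.
  by apply: eq_bigr => j _ /=; rewrite linearZ /= trmxK.
have XB : X \in frakB C n.
  by do 2!(apply: memv_suml => ? _); apply/memvZ/frame_unit_frakB.
exists X; split=> // [|i j].
  rewrite comW // XT mulmx_suml; apply: eq_bigr => i _; rewrite mulmx_suml.
  by apply: eq_bigr => j _; rewrite -scalemxAl -mulmxA frame_RW.
rewrite XT mulmx_sumr mulmx_suml (bigD1 i) //=.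
rewrite [X in _ + X]big1 ?addr0 => [|k k_i]; last first.
  rewrite mulmx_sumr mulmx_suml big1 // => l _.
  rewrite -scalemxAr mulmxA RD eq_sym (negPf k_i) raddf0 mul0mx.
  by rewrite scaler0 mul0mx.
rewrite mulmx_sumr mulmx_suml (bigD1 j) //= big1 => [|k /negPf k_j].
  rewrite addr0 -scalemxAr mulmxA RD eqxx mul1mx -scalemxAl RD eqxx.
  by rewrite scale_scalar_mx mulr1.
by rewrite -scalemxAr mulmxA RD eqxx mul1mx -scalemxAl RD k_j raddf0 scaler0.
Qed.

End Frame.

Section Isotypic.

Variables (K : nat) (chi : 'I_K -> {ffun Iso1 n -> C}).
Hypothesis chi_irr : enumerates_irr_characters chi.

Lemma Wmx_frakB k (X : 'M[C]_N) :
  X \in frakB C n -> Wmx (chi k) *m X^T = X^T *m Wmx (chi k).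
Proof. by move=> /frakBP; apply: Wmx_comm. Qed.

Lemma block_of_isotypic k m v (u : m.-tuple 'cV[C]_N) :
  has_multiplicity (chi k) m ->
  ((0 < m)%N -> (v^T <= Wmx (chi k))%MS) ->
  ((0 < m)%N -> \dim (frakB_orbit v) = m) ->
  ((0 < m)%N -> orthogonal_basis (frakB_orbit v) u) ->
  [/\ normalized_mx u *m Wmx (chi k) = normalized_mx u,
      {in frakB C n &, forall X X',
         block_of u (X *m X') = block_of u X' *m block_of u X},
      {in frakB C n, forall X, block_of u X = 0 -> Wmx (chi k) *m X^T = 0}
    & forall Z, exists X, [/\ X \in frakB C n, block_of u X = Z
        & Wmx (chi k) *m X^T = X^T]].
Proof.
move=> multm vW dimU uP.
have [d [A [R [D frameW]]]] := isotypic_frame_exists chi_irr multm.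
have comW := @Wmx_frakB k.
have [Q [unitQ EW blockP]] := block_conj frameW comW vW dimU uP.
split=> // [X X' XB XB' | X XB | Z].
- have [y yP] := frame_coefs frameW XB; have [y' yP'] := frame_coefs frameW XB'.
  have yP2 := frame_coefs_mul frameW comW XB' yP' yP.
  rewrite (blockP _ _ XB yP) (blockP _ _ XB' yP') (blockP _ _ _ yP2).
    by rewrite !mulmxA mulmxK.
  apply/frakBP=> g; move/frakBP: XB => XB; move/frakBP: XB' => XB'.
  by rewrite trmx_mul mulmxA XB' -!mulmxA XB.
- have [y yP] := frame_coefs frameW XB; rewrite (blockP _ _ XB yP) => yQ0.
  have y0 : y = 0.
    rewrite -[y](mulmxK unitQ) -[y *m Q](mulKVmx unitQ) (mulmxA (invmx Q)).
    by rewrite yQ0 mulmx0 mul0mx.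
  have [_ _ _ _ <-] := frameW; rewrite mulmx_suml big1 // => i _.
  rewrite -mulmxA (frame_act frameW comW _ XB yP) big1 ?mulmx0 // => j _.
  by rewrite y0 mxE scale0r.
(* The lifted matrix is [Q Z Q^-1], since taking the block conjugates by [Q^-1]. *)
have [X [XB WX yP]] := frame_lift frameW comW (Q *m Z *m invmx Q).
exists X; split=> //; rewrite (blockP _ _ XB yP) !mulmxA mulVmx // mul1mx.
by rewrite mulmxKV.
Qed.

End Isotypic.

End Block.

(** * Diagonal joins *)

Section MxDiag.

Variables (C : numClosedFieldType) (K : nat) (p : 'I_K -> nat).
Implicit Types B : forall k, 'M[C]_(p k).

Lemma mul_mxdiag B B' :
  (\mxdiag_k B k) *m (\mxdiag_k B' k) = \mxdiag_k (B k *m B' k).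
Proof.
rewrite [X in _ *m X]/mxdiag mul_mxdiag_mxblock; apply/eq_mxblock => i j.
by case: eqVneq => [->|_]; rewrite ?conform_mx_id ?mulmx0.
Qed.

Lemma scale_mxdiag a B : a *: (\mxdiag_k B k) = \mxdiag_k (a *: B k).
Proof.
rewrite -mul_scalar_mx -mxdiagZ mul_mxdiag.
by apply/eq_mxdiag => k; rewrite mul_scalar_mx.
Qed.

Lemma adjoint_mxdiag B :
  adjoint_mx (\mxdiag_k B k) = \mxdiag_k (adjoint_mx (B k)).
Proof.
rewrite /adjoint_mx -tr_mxdiag; congr _^T; apply/matrixP=> s t; rewrite !mxE.
case: (tagnat.sig1 s =P tagnat.sig1 t) => [e|_]; last by rewrite !mxE conjC0.
by move: (tagnat.sig2 s); rewrite e => a; rewrite !conform_mx_id mxE.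
Qed.

End MxDiag.

(** * The block map over all components *)

Section BlockMap.

Variables (C : numClosedFieldType) (n K : nat) (mult : 'I_K -> nat).
Variable u : forall k, (mult k).-tuple 'cV[C]_(nperm n).

Local Notation N := (nperm n).

Lemma block_of_is_linear m (t : m.-tuple 'cV[C]_N) : linear (block_of t).
Proof.
move=> a X Y; rewrite /block_of linearP mulmxDr mulmxDl.
by rewrite -scalemxAr -scalemxAl.
Qed.

HB.instance Definition _ m (t : m.-tuple 'cV[C]_N) :=
  GRing.isLinear.Build C 'M[C]_N 'M[C]_m _ (block_of t) (block_of_is_linear t).

(** The block is a compression, of the form [E X^T E^*], and compressions commute with adjoints. *)
Lemma block_of_adjoint m (t : m.-tuple 'cV[C]_N) X :
  (block_of t (adjoint_mx X))^T = adjoint_mx (block_of t X)^T.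
Proof.
rewrite /block_of /adjoint_mx trmxK map_trmx trmxK !trmx_mul !map_mxM !map_trmx.
by rewrite map_mxCK !trmxK mulmxA.
Qed.

Definition block_map (X : 'M[C]_N) : 'M[C]_(\sum_k mult k) :=
  \mxdiag_k (block_of (u k) X)^T.

Lemma block_map_is_linear : linear block_map.
Proof.
move=> a X Y; rewrite /block_map scale_mxdiag -mxdiagD.
by apply/eq_mxdiag => k; rewrite !linearP.
Qed.

HB.instance Definition _ :=
  GRing.isLinear.Build C 'M[C]_N _ _ block_map block_map_is_linear.

Variables (chi : 'I_K -> {ffun Iso1 n -> C}) (v : 'I_K -> 'cV[C]_N).
Hypothesis chi_irr : enumerates_irr_characters chi.
Hypothesis multP : forall k, has_multiplicity (chi k) (mult k).
Hypothesis vW : forall k, (0 < mult k)%N -> ((v k)^T <= Wmx (chi k))%MS.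
Hypothesis dimU :
  forall k, (0 < mult k)%N -> \dim (frakB_orbit (v k)) = mult k.
Hypothesis uP :
  forall k, (0 < mult k)%N -> orthogonal_basis (frakB_orbit (v k)) (u k).

Let isotypic k := block_of_isotypic chi_irr (multP k) (@vW k) (@dimU k) (@uP k).

(** A zero block in component [k] kills [Wmx (chi k) *m X^T], and the projections sum to the
    identity. *)
Lemma block_of_inj X : X \in frakB C n ->
  (forall k, block_of (u k) X = 0) -> X = 0.
Proof.
move=> XB X0; apply: trmx_inj; rewrite trmx0 -[X^T]mul1mx -(sum_Wmx chi_irr).
rewrite mulmx_suml big1 // => k _.
by have [_ _ inj_k _] := isotypic k; apply: inj_k.
Qed.

Lemma block_of_surj (Z : forall k, 'M[C]_(mult k)) :
  exists2 X, X \in frakB C n & forall k, block_of (u k) X = Z k.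
Proof.
have /fin_all_exists[X XP] k : exists Xk, [/\ Xk \in frakB C n,
    block_of (u k) Xk = Z k & forall l, l != k -> block_of (u l) Xk = 0].
  have [_ _ _ /(_ (Z k))[X [XB XZ WX]]] := isotypic k.
  exists X; split=> // l l_k; have [EW _ _ _] := isotypic l.
  (* The product of the projections to components [l] and [k] appears in the middle, and it is
     zero. *)
  rewrite /block_of -EW -WX -(mulmxA (normalized_mx _)) (mulmxA (Wmx _)).
  by rewrite (mulmx_Wmx chi_irr) (negPf l_k) mul0mx mulmx0 mul0mx.
exists (\sum_k X k) => [|k]; first by apply: memv_suml => k _; case: (XP k).
rewrite linear_sum (bigD1 k) //= big1 => [|l l_k].
  by rewrite addr0; case: (XP k).
by case: (XP l) => _ _ -> //; rewrite eq_sym.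
Qed.

Lemma block_map_star_isomorphism :
  star_isomorphism (frakB C n) (fun Z => block_diagonal Z) block_map.
Proof.
split=> [X Y XB YB eqXY | Z | X Y XB YB | X XB].
- pose b X k := (block_of (u k) X)^T.
  have {}eqXY := (eq_mxdiagP (b X) (b Y)).2 eqXY.
  apply/eqP; rewrite -subr_eq0; apply/eqP/block_of_inj; first exact: rpredB.
  by move=> k; rewrite linearB /= (trmx_inj (eqXY k)) subrr.
- split=> [[Y ->] | [X _ <-]]; last by eexists.
  have [X XB XY] := block_of_surj (fun k => (Y k)^T).
  by exists X => //; apply/eq_mxdiag => k; rewrite XY trmxK.
- rewrite /block_map mul_mxdiag; apply/eq_mxdiag => k; rewrite -trmx_mul.
  by have [_ mulB _ _] := isotypic k; rewrite mulB.
rewrite /block_map adjoint_mxdiag; apply/eq_mxdiag => k.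
exact: block_of_adjoint.
Qed.

Lemma block_diagonal_generated :
  generated_by (fun Z : 'M[C]_(\sum_k mult k) => block_diagonal Z)
    (fun Z => exists2 w, w \in iso1_orbits n
                       & Z = \mxdiag_k basic_block (u k) w).
Proof.
have genE w :
    \mxdiag_k basic_block (u k) w = \mxdiag_k block_of (u k) (orbit_mx C w).
  by apply/eq_mxdiag => k; apply: basic_blockE.
move=> Z; split=> [[Y ->] S _ gensS | ZS].
  (* The joins carry no transposes, unlike [block_map]; [Y] is lifted through the untransposed
     blocks, and expanding the lift in orbit matrices writes [Y] as a combination of the joins. *)
  have [X XB XY] := block_of_surj Y.
  have /frakBP/hat_mx_commP/invariant_orbit_sum[c defX] := XB.
  have -> : \mxdiag_k Y k =
      \sum_(w in iso1_orbits n) c w *: \mxdiag_k basic_block (u k) w.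
    transitivity
        (\sum_(w in iso1_orbits n) \mxdiag_k (c w *: basic_block (u k) w)).
      rewrite -mxdiag_sum; apply/eq_mxdiag => k; rewrite -XY defX linear_sum.
      by apply: eq_bigr => w _; rewrite linearZ basic_blockE.
    by apply: eq_bigr => w _; rewrite scale_mxdiag.
  by apply: memv_suml => w w_orb; apply/memvZ/gensS; exists w.
have [_ imB _ _] := block_map_star_isomorphism.
(* Conversely, the block diagonal matrices are themselves a unital subalgebra containing the joins;
   as the image of [frakB] they are presented as a vector space. *)
pose S := (linfun block_map @: frakB C n)%VS.
have SP T : T \in S <-> block_diagonal T.
  rewrite imB; split=> [/memv_imgP[X XB ->] | [X XB <-]].
    by exists X; rewrite ?lfunE.
  by apply/memv_imgP; exists X; rewrite ?lfunE.
apply/SP; apply: ZS => [|_ [w _ ->]]; last by apply/SP; eexists.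
split=> [|X Y /SP[X' ->] /SP[Y' ->]]; apply/SP.
  by exists (fun k => 1%:M); rewrite mxdiagZ.
by rewrite mul_mxdiag; eexists.
Qed.

End BlockMap.

Theorem proposition5p1 (R : realType) (n : nat) (n_gt0 : (0 < n)%N)
  (chi : 'I_(2 * npartitions n) -> {ffun Iso1 n -> R[i]})
  (chi_irr : enumerates_irr_characters chi)
  (mult : 'I_(2 * npartitions n) -> nat)
  (multP : forall k, has_multiplicity (chi k) (mult k))
  (v : 'I_(2 * npartitions n) -> 'cV[R[i]]_(nperm n))
  (vW : forall k, (0 < mult k)%N -> ((v k)^T <= Wmx (chi k))%MS)
  (dimU : forall k, (0 < mult k)%N -> \dim (frakB_orbit (v k)) = mult k)
  (u : forall k, (mult k).-tuple 'cV[R[i]]_(nperm n))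
  (uP : forall k, (0 < mult k)%N ->
          orthogonal_basis (frakB_orbit (v k)) (u k)) :
  star_isomorphic (frakB _ n)
    (fun Z : 'M[R[i]]_(\sum_k mult k) => block_diagonal Z) /\
  generated_by
    (fun Z : 'M[R[i]]_(\sum_k mult k) => block_diagonal Z)
    (fun Z => exists2 w, w \in iso1_orbits n
                       & Z = \mxdiag_k basic_block (u k) w).
Proof.
split; last exact: block_diagonal_generated chi_irr multP vW dimU uP.
by eexists; apply: block_map_star_isomorphism chi_irr multP vW dimU uP.
Qed.
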